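(* Let $R$ be a $G$-graded commutative ring, let $M$ be a graded-Noetherian $G$-graded $R$-module, and let $N$ be a graded $R$-submodule of $M$. Then there exists $s\in h^*(R)$ such that $N\in GSpec_{s}({}_{R}M)$.
   Context: $G$ is a group with identity $e$; rings are commutative with nonzero unity $1$ and modules are unital. A ring $R$ is $G$-graded if $R=\bigoplus_{g\in G}R_g$ with additive subgroups $R_g$ satisfying $R_gR_h\subseteq R_{gh}$; $h(R)=\bigcup_{g\in G}R_g$ is the set of homogeneous elements and $h^*(R)=h(R)\setminus\{0\}$. An $R$-module $M$ is $G$-graded if $M=\bigoplus_{g\in G}M_g$ with additive subgroups $M_g$ satisfying $R_gM_h\subseteq M_{gh}$; $h(M)=\bigcup_{g\in G}M_g$. A submodule $N$ of $M$ is graded if $N=\bigoplus_{g\in G}(N\cap M_g)$. Write $(N:_RM)=\{r\in R: rM\subseteq N\}$. For $s\in h^*(R)$, a graded $R$-submodule $N$ of $M$ is graded $s$-prime if $s\notin(N:_RM)$ and, for all $r\in h(R)$ and $m\in h(M)$, $rm\in N$ implies $sr\in(N:_RM)$ or $sm\in N$. $GSpec_s({}_RM)$ is the set of all graded $s$-prime $R$-submodules of $M$. $M$ is graded-Noetherian if it satisfies the ascending chain condition on graded submodules.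
   Formalization: The graded submodule N is additionally assumed to be proper (N ≠ M); for N = M the claim fails, since (M :_R M) = R contains every s. *)

(* Defs.v *)
From mathcomp Require Import all_boot all_order all_algebra.
From mathcomp Require Import boolp classical_sets functions cardinality fsbigop.

Set Implicit Arguments.
Unset Strict Implicit.
Unset Printing Implicit Defensive.

Import GRing.Theory.
Local Open Scope classical_set_scope.
Local Open Scope ring_scope.

(* [groupType] allows infinite and noncommutative groups. *)

Definition homogeneous_decomposition (G : groupType) (V : zmodType)
    (V_ : G -> set V) (x : V) (f : G -> V) : Prop :=
  [/\ forall g, V_ g (f g), finite_set [set g | f g != 0]
    & x = \sum_(g \in [set: G]) f g].

(* Internal direct sum of additive subgroups: W = \bigoplus_g V_ g. *)
Definition is_direct_sum (G : groupType) (V : zmodType)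
    (W : set V) (V_ : G -> set V) : Prop :=
  [/\ forall g, zmod_closed [in V_ g],
      forall x, W x <-> exists f, homogeneous_decomposition V_ x f
    & forall x f f', homogeneous_decomposition V_ x f ->
        homogeneous_decomposition V_ x f' -> f = f'].

Definition homogeneous (G : groupType) (V : zmodType) (V_ : G -> set V) :
    set V :=
  \bigcup_(g in [set: G]) V_ g.

Definition nonzero_homogeneous (G : groupType) (V : zmodType)
    (V_ : G -> set V) : set V :=
  homogeneous V_ `\ 0.

Definition graded_ring (G : groupType) (R : comNzRingType)
    (R_ : G -> set R) : Prop :=
  is_direct_sum [set: R] R_ /\
  forall g h a b, R_ g a -> R_ h b -> R_ (g * h)%g (a * b).

Definition graded_module (G : groupType) (R : comNzRingType)
    (R_ : G -> set R) (M : lmodType R) (M_ : G -> set M) : Prop :=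
  is_direct_sum [set: M] M_ /\
  forall g h a m, R_ g a -> M_ h m -> M_ (g * h)%g (a *: m).

Definition graded_submodule (G : groupType) (R : comNzRingType)
    (M : lmodType R) (M_ : G -> set M) (N : set M) : Prop :=
  submod_closed [in N] /\ is_direct_sum N (fun g => N `&` M_ g).

Definition graded_noetherian (G : groupType) (R : comNzRingType)
    (M : lmodType R) (M_ : G -> set M) : Prop :=
  forall L : nat -> set M,
    (forall n, graded_submodule M_ (L n)) ->
    (forall n, L n `<=` L n.+1) ->
    exists k, forall n, (k <= n)%N -> L n = L k.

(* The residual (N :_R M). *)
Definition colon (R : comNzRingType) (M : lmodType R) (N : set M) : set R :=
  [set r | forall m : M, N (r *: m)].

Definition graded_sprime (G : groupType) (R : comNzRingType)
    (R_ : G -> set R) (M : lmodType R) (M_ : G -> set M)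
    (s : R) (N : set M) : Prop :=
  [/\ graded_submodule M_ N,
      ~ colon N s
    & forall r m, homogeneous R_ r -> homogeneous M_ m ->
        N (r *: m) -> colon N (s * r) \/ N (s *: m)].

Definition GSpec (G : groupType) (R : comNzRingType)
    (R_ : G -> set R) (M : lmodType R) (M_ : G -> set M) (s : R) :
    set (set M) :=
  [set N | graded_sprime R_ M_ s N].

(* Main.v *)
(* Among the graded submodules (N :_M s) = {m | s m \in N}, where s ranges
   over the homogeneous elements outside (N :_R M), choose a maximal one.
   If r m \in N and s r \notin (N :_R M), then s r is again homogeneous and
   (N :_M s) is contained in (N :_M s r), so the two are equal by maximality;
   the latter contains m, hence s m \in N. *)

Require Import Defs.
From mathcomp Require Import all_boot all_order all_algebra.
From mathcomp Require Import boolp classical_sets functions cardinality fsbigop.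

Set Implicit Arguments.
Unset Strict Implicit.
Unset Printing Implicit Defensive.

Import GRing.Theory.
Local Open Scope classical_set_scope.
Local Open Scope ring_scope.

Lemma fsumr_closed (V : zmodType) (I : choiceType) (W : set V) (D : set I)
    (f : I -> V) :
  zmod_closed [in W] -> (forall i, W (f i)) -> W (\sum_(i \in D) f i).
Proof.
move=> /GRing.zmod_closed0D [W0 WD] Wf.
(* The big operator runs over a finite list of indices, empty by default when the support is
   infinite, so induction on it covers every [f]. *)
elim/big_ind: _ => [|x y Wx Wy|//]; first by rewrite inE in W0.
by have := WD x y; rewrite !inE; apply.
Qed.

Lemma scaler_fsumr (R : pzRingType) (M : lmodType R) (I : choiceType) (a : R)
    (f : I -> M) :
  finite_set [set i | f i != 0] ->
  a *: (\sum_(i \in [set: I]) f i) = \sum_(i \in [set: I]) a *: f i.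
Proof.
move=> ffin; have f0 i : ~ (f i != 0) -> f i = 0 by move=> /negP/negPn/eqP.
(* Scaling by [a] may kill some terms, so both sums are cut down to the common finite index set
   where [f] is nonzero. *)
rewrite -!(@fsbig_widen _ _ _ _ [set i | f i != 0] setT)//; last 2 first.
- by move=> i [_ /= /f0 ->]; rewrite scaler0.
- by move=> i [_ /= /f0].
by rewrite !fsbig_finite// scaler_sumr.
Qed.

Lemma direct_sum_homogeneous_sub (G : groupType) (V : zmodType)
    (V_ : G -> set V) (W : set V) :
  is_direct_sum [set: V] V_ -> zmod_closed [in W] ->
  homogeneous V_ `<=` W -> W = setT.
Proof.
move=> [_ dec _] Wcl VW; apply/seteqP; split=> // x /dec [f [Vf _ ->]].
by apply: fsumr_closed => // g; apply: VW; exists g.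
Qed.

(** Multiplication by [s] shifts degrees by [h] on the left, so the part of [s *: x] in degree [g]
    comes from degree [h^-1 * g]; left translation is a bijection of [G], which reindexes the
    sum. *)
Lemma homogeneous_decomposition_scale (G : groupType) (R : comNzRingType)
    (R_ : G -> set R) (M : lmodType R) (M_ : G -> set M) (h : G) (s : R)
    (x : M) (f : G -> M) :
  graded_module R_ M_ -> R_ h s -> homogeneous_decomposition M_ x f ->
  homogeneous_decomposition M_ (s *: x) (fun g => s *: f (h^-1 * g)%g).
Proof.
move=> [_ RM] Rs [Mf ffin xE]; split.
- by move=> g; rewrite -[X in M_ X](mulVKg h); apply: RM.
- apply: sub_finite_set (finite_image (fun g => (h * g)%g) ffin) => g /= nz.
  exists (h^-1 * g)%g; last by rewrite mulVKg.
  by apply: contra_neq nz => ->; rewrite scaler0.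
- have bij : bijective (fun g => (h * g)%g).
    by exists (fun g => (h^-1 * g)%g); [exact: mulKg|exact: mulVKg].
  rewrite (reindex_fsbigT _ _ bij) xE.
  under [RHS]eq_fsbigr do rewrite mulKg.
  by rewrite scaler_fsumr.
Qed.

(** A decomposition of [x] inside [N] is also one inside [M], so uniqueness in [M] identifies it
    with [f]. *)
Lemma graded_submodule_component (G : groupType) (R : comNzRingType)
    (M : lmodType R) (M_ : G -> set M) (N : set M) (x : M) (f : G -> M) :
  is_direct_sum [set: M] M_ -> graded_submodule M_ N -> N x ->
  homogeneous_decomposition M_ x f -> forall g, N (f g).
Proof.
move=> [_ _ uniqM] [_ [_ decN _]] /decN [f' [NMf' fin' xE]] fdec g.
have f'dec : homogeneous_decomposition M_ x f'.
  by split=> // k; case: (NMf' k).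
by rewrite (uniqM _ _ _ fdec f'dec); case: (NMf' g).
Qed.

Lemma graded_submodule_preimage_scale (G : groupType) (R : comNzRingType)
    (R_ : G -> set R) (M : lmodType R) (M_ : G -> set M) (N : set M) (s : R) :
  graded_module R_ M_ -> graded_submodule M_ N -> homogeneous R_ s ->
  graded_submodule M_ [set m | N (s *: m)].
Proof.
move=> gM gN [h _ Rs]; have [[clM decM uniqM] _] := gM.
have [[N0 Nlin] _] := gN.
have Kcl : submod_closed [in [set m | N (s *: m)]].
  split=> [|a u v]; rewrite !inE /=; first by rewrite inE in N0; rewrite scaler0.
  move=> Nu Nv; rewrite scalerDr scalerA mulrC -scalerA.
  by have := Nlin a (s *: u) (s *: v); rewrite !inE; apply.
split=> //; split.
- move=> g; have [M0 MB] := clM g; have [K0 KB] := GRing.submod_closedB Kcl.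
  split=> [|u v]; first by move: M0 K0; rewrite !inE.
  rewrite !inE => -[Ku Mu] [Kv Mv]; split.
    by have := KB u v; rewrite !inE; apply.
  by have := MB u v; rewrite !inE; apply.
- move=> x; split=> [Kx|[f [KMf _ ->]]]; last first.
    apply: (@fsumr_closed _ _ [set m | N (s *: m)]).
      exact: GRing.submod_closedB.
    by move=> g; case: (KMf g).
  have [f fdec] := (decM x).1 I; exists f; case: (fdec) => Mf ffin xE.
  split=> // g; split=> //=.
  (* The component of [s *: x] in degree [h * g] is [s *: f g]; it lies in [N] because [N] is
     graded. *)
  have sfdec := homogeneous_decomposition_scale gM Rs fdec.
  have := graded_submodule_component gM.1 gN Kx sfdec (h * g)%g.
  by rewrite mulKg.
- by move=> x f f' [KMf ? ?] [KMf' ? ?]; apply: (uniqM x);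
    split=> // g; [case: (KMf g)|case: (KMf' g)].
Qed.

(** Without a maximal member, every member of [C] is strictly contained in another, and dependent
    choice builds a strictly increasing chain that never stabilizes. *)
Lemma graded_noetherian_maximal (G : groupType) (R : comNzRingType)
    (M : lmodType R) (M_ : G -> set M) (C : set (set M)) :
  graded_noetherian M_ -> C `<=` graded_submodule M_ -> C !=set0 ->
  exists2 L, C L & forall L', C L' -> L `<=` L' -> L' = L.
Proof.
move=> noeth Cgr [L0 CL0]; apply: contrapT => nomax.
pose next (L L' : {L | C L}) := sval L `<=` sval L' /\ sval L' <> sval L.
have step L : {L' | next L L'}.
  apply: cid; apply: contrapT => noL'; apply: nomax; exists (sval L).
    exact: svalP.
  move=> L' CL' LL'; apply: contrapT => ne; apply: noL'.
  by exists (exist _ L' CL').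
have [F [_ Fnext]] := dependent_choice step (exist _ L0 CL0).
have [n|n|k Fk] := noeth (fun n => sval (F n)).
- exact/Cgr/svalP.
- exact: (Fnext n).1.
- by apply: (Fnext k).2; apply: Fk.
Qed.

Theorem theorem4p5 (G : groupType) (R : comNzRingType) (R_ : G -> set R)
    (M : lmodType R) (M_ : G -> set M) (N : set M)
    (gradedR : graded_ring R_)
    (gradedM : graded_module R_ M_)
    (noetherianM : graded_noetherian M_)
    (gradedN : graded_submodule M_ N)
    (properN : N <> setT) :
  exists s : R, nonzero_homogeneous R_ s /\ GSpec R_ M_ s N.
Proof.
have [Ncl _] := gradedN; have [N0 NB] := GRing.submod_closedB Ncl.
have [_ Nlin] := Ncl; rewrite inE in N0.
have colon_cl : zmod_closed [in colon N].
  split=> [|a b]; rewrite !inE; first by move=> m; rewrite scale0r.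
  move=> Na Nb m; rewrite scalerBl.
  by have := NB (a *: m) (b *: m); rewrite !inE; apply.
pose outside := [set s | homogeneous R_ s /\ ~ colon N s].
pose K s := [set m | N (s *: m)].
(* Properness enters here: if every homogeneous element lay in [colon N], so would all their sums,
   in particular [1], forcing [N] to be all of [M]. *)
have [s0 out0] : outside !=set0.
  apply: contrapT => no; apply: properN; apply/seteqP; split=> // m _.
  have colonT : colon N = setT.
    apply: direct_sum_homogeneous_sub gradedR.1 colon_cl _ => s hs.
    by apply: contrapT => ns; apply: no; exists s.
  have : colon N 1 by rewrite colonT.
  by move/(_ m); rewrite scale1r.
have [||_ [s [hs ns] <-] maxs] :=
  @graded_noetherian_maximal _ _ _ _ (K @` outside) noetherianM.
- by move=> _ [s [hs _] <-]; exact: graded_submodule_preimage_scale hs.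
- by exists (K s0); exists s0.
(* The chosen [s] is nonzero because [0] always belongs to [colon N]. *)
exists s; split; first by split=> // s_eq0; apply: ns => m; rewrite s_eq0 scale0r.
split=> // r m hr hm Nrm; case: (pselect (colon N (s * r))) => nsr; first by left.
right; have outsr : outside (s * r).
  split=> //; have [g _ Rg] := hs; have [h _ Rh] := hr.
  by exists (g * h)%g => //; apply: gradedR.2.
have NZ a u : N u -> N (a *: u).
  by move=> Nu; have := Nlin a u 0; rewrite !inE addr0; apply.
have KE : K (s * r) = K s.
  apply: maxs; first by exists (s * r).
  (* By commutativity, [s * r] acts on [u] as [r] applied to [s *: u], which is already in [N]. *)
  by move=> u Ku; rewrite /K /= mulrC -scalerA; apply: NZ.
suff : K (s * r) m by rewrite KE.
by rewrite /K /= -scalerA; apply: NZ.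
Qed.
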